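(* Consider the fluid queueing network described in the context, with routing matrix $R=(r(i,j))$, with external arrival rates $e(i)(\cdot)$ and service rates $c(i)(\cdot)$ all periodic with the same period $T>0$. Suppose the stability condition holds: there exists $\epsilon>0$ such that, componentwise, $\bar c > [I-R^\top]^{-1}\bar e+\epsilon \mathbf 1$. Suppose every vehicle leaves after visiting at most $K$ queues, for some integer $K\geq 1$ (i.e. $R^K=0$). Then every state trajectory $(x,\beta)$ converges in finite time to the unique periodic state trajectory $(x^*,\beta^* )$ of period $T$: for each admissible initial condition there is $t^*<\infty$ such that $(x(t),\beta(t))=(x^*(t),\beta^*(t))$ for all $t\ge t^*$.
   Context: Network: there are finitely many queues $i=1,\dots,n$. The routing ratios satisfy $r(i,j)\ge 0$, $\sum_j r(i,j)\le 1$ ($r(i,j)$ is the fraction of vehicles leaving queue $i$ that go to queue $j$; the remaining fraction leaves the network). $R=(r(i,j))$ and $R^\top$ is its transpose; $[I-R^\top]^{-1}=I+R^\top+(R^\top)^2+\cdots$ exists. Travel times are $\tau(i,j)>0$; $\bar\tau=\max\tau(i,j)$. The external arrival rates $e(i)(t)\ge0$ and service (saturation) rates $c(i)(t)\ge 0$, $t\ge0$, are measurable and locally integrable. Queues have infinite storage capacity. An admissible initial condition consists of $x(i)(0)\ge0$ and an integrable departure history $b(i)(s)\ge0$, $s\in[-\bar\tau,0]$, for every $i$. The corresponding trajectory is the unique (departure rates being identified when equal almost everywhere) family of absolutely continuous queue lengths $x(i)(t)\ge0$, $t\ge0$, and departure rates $b(i)(t)$ such that, for almost every $t\ge 0$ and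 all $i$, $$\dot x(i)(t)=e(i)(t)+\sum_j b(j)(t-\tau(j,i))\,r(j,i)-b(i)(t),$$ $$b(i)(t)=c(i)(t)\ \text{if } x(i)(t)>0,\qquad b(i)(t)\in[0,c(i)(t)]\ \text{if } x(i)(t)=0 .$$ The state at time $t\ge0$ is $(x(t),\beta(t))$, where $\beta(t)$ is the departure history $s\in[t-\bar\tau,t]\mapsto b(s)$ (histories equal almost everywhere are identified). A state trajectory is periodic with period $T$ if $x(t+T)=x(t)$ for all $t\ge0$ and $b(s+T)=b(s)$ for almost every $s\ge-\bar\tau$. Under periodicity of $e,c$ and the stability condition there is exactly one periodic state trajectory with period $T$, denoted $(x^*,\beta^* )$. Averages: $\bar e(i)=\frac1T\int_0^T e(i)(t)\,dt$, $\bar c(i)=\frac1T\int_0^T c(i)(t)\,dt$; $\bar e,\bar c$ are the vectors of these; $\mathbf 1$ is the all-ones vector. *)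

(* Defs.v *)
(* MathComp-Analysis, over an arbitrary [R : realType]. *)
From HB Require Import structures.
From mathcomp Require Import all_boot all_order all_algebra.
From mathcomp Require Import all_classical all_reals all_analysis.

Set Implicit Arguments.
Unset Strict Implicit.
Unset Printing Implicit Defensive.

Import Order.TTheory GRing.Theory Num.Theory.
Import numFieldNormedType.Exports.

Local Open Scope classical_set_scope.
Local Open Scope ring_scope.

(* The library's [locally_integrable] is for open domains, hence not usable on
   the closed half-line. *)
Definition integrable_from (R : realType) (a : R) (f : R -> R) : Prop :=
  forall u : R, (@lebesgue_measure R).-integrable `[a, u] (EFin \o f).

(* The intervals [u k, v k] are non-overlapping: they may share endpoints. *)
Definition absolutely_continuous_on (R : realType) (a b : R) (f : R -> R)
    : Prop :=
  forall eps : R, 0 < eps -> exists2 delta : R, 0 < delta &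
    forall (m : nat) (u v : 'I_m -> R),
      (forall k, a <= u k /\ u k <= v k /\ v k <= b) ->
      (forall k l, k != l -> v k <= u l \/ v l <= u k) ->
      \sum_(k < m) (v k - u k) < delta ->
      \sum_(k < m) `|f (v k) - f (u k)| < eps.

(* The values of [arr] and [srv] at negative times are irrelevant.  For a
   nonnegative matrix with row sums at most 1, [rt_unit] is equivalent to the
   convergence of the Neumann series of [rt^T], whose sum is then the inverse. *)
Record fluid_network (R : realType) (n : nat) := FluidNetwork {
  rt : 'M[R]_n;
  tau : 'M[R]_n;
  arr : 'I_n -> R -> R;
  srv : 'I_n -> R -> R;
  rt_ge0 : forall i j, 0 <= rt i j;
  rt_sum_le1 : forall i, \sum_j rt i j <= 1;
  rt_unit : 1%:M - rt^T \in unitmx;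
  tau_gt0 : forall i j, 0 < tau i j;
  arr_ge0 : forall i t, 0 <= t -> 0 <= arr i t;
  srv_ge0 : forall i t, 0 <= t -> 0 <= srv i t;
  arr_integrable : forall i, integrable_from 0 (arr i);
  srv_integrable : forall i, integrable_from 0 (srv i)
}.

(* Travel times are positive, so 0 is a neutral starting value. *)
Definition taumax (R : realType) (n : nat) (N : fluid_network R n) : R :=
  \big[Num.max/0]_i \big[Num.max/0]_j tau N i j.

Definition admissible_initial (R : realType) (n : nat) (N : fluid_network R n)
    (x0 : 'I_n -> R) (b0 : 'I_n -> R -> R) : Prop :=
  forall i,
    [/\ 0 <= x0 i,
        (@lebesgue_measure R).-integrable `[- taumax N, 0] (EFin \o b0 i) &
        forall s, - taumax N <= s <= 0 -> 0 <= b0 i s].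

(* [x] is meaningful on [0, +oo[ and [b] on [- taumax, +oo[; the departure
   rates are understood up to null sets. *)
Definition trajectory (R : realType) (n : nat) (N : fluid_network R n)
    (x0 : 'I_n -> R) (b0 : 'I_n -> R -> R) (x b : 'I_n -> R -> R) : Prop :=
  [/\ forall i, x i 0 = x0 i,
      {ae (@lebesgue_measure R), forall s : R,
         - taumax N <= s <= 0 -> forall i, b i s = b0 i s},
      forall i, [/\ forall t, 0 <= t -> 0 <= x i t,
                    forall u, 0 <= u -> absolutely_continuous_on 0 u (x i) &
                    integrable_from (- taumax N) (b i)] &
      {ae (@lebesgue_measure R), forall t : R, 0 <= t -> forall i,
         [/\ is_derive t (1 : R) (x i)
               (arr N i t + \sum_j b j (t - tau N j i) * rt N j i - b i t),
             0 < x i t -> b i t = srv N i t &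
             x i t = 0 -> 0 <= b i t <= srv N i t]}].

(* Equality of the states (x(t), beta(t)), where beta(t) is the class of the
   departure history on [t - taumax, t] modulo null sets. *)
Definition same_state (R : realType) (n : nat) (N : fluid_network R n) (t : R)
    (x b x' b' : 'I_n -> R -> R) : Prop :=
  (forall i, x i t = x' i t) /\
  {ae (@lebesgue_measure R), forall s : R,
     t - taumax N <= s <= t -> forall i, b i s = b' i s}.

Definition periodic_trajectory (R : realType) (n : nat)
    (N : fluid_network R n) (T : R) (x b : 'I_n -> R -> R) : Prop :=
  [/\ exists x0 b0, admissible_initial N x0 b0 /\ trajectory N x0 b0 x b,
      forall i t, 0 <= t -> x i (t + T) = x i t &
      {ae (@lebesgue_measure R), forall s : R,
         - taumax N <= s -> forall i, b i (s + T) = b i s}].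

Definition mean (R : realType) (n : nat) (T : R) (f : 'I_n -> R -> R)
    : 'cV[R]_n :=
  \col_i (T^-1 * \int[@lebesgue_measure R]_(t in `[0, T]) f i t).

Definition stable (R : realType) (n : nat) (N : fluid_network R n) (T : R)
    : Prop :=
  exists2 eps : R, 0 < eps &
    forall i, (invmx (1%:M - (rt N)^T) *m mean T (arr N) + const_mx eps) i 0
              < mean T (srv N) i 0.

(* Main.v *)
(* Fix the inflow of one queue. Two trajectories that start differently cannot
   separate once they meet, and under a negative mean drift each of them empties
   again and again, so by the intermediate value theorem they do meet, after
   which lengths and departures agree. The queue that starts empty is the
   reflection [Y t - inf_{s <= t} Y s] of its net input [Y]; periodicity with
   negative drift makes it periodic after one period, and its mean departure rate
   is its mean inflow. Since [R ^ K = 0] the routing graph has no cycle, so both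
   facts propagate by induction on the length of the longest path into a queue:
   once all upstream departures are periodic (resp. have merged), so has the
   inflow after one more maximal travel time. *)
Require Import Defs.
From mathcomp Require Import all_boot all_order all_algebra.
From mathcomp Require Import all_classical all_reals all_analysis.
From mathcomp Require Import measurable_realfun.
From mathcomp Require Import ring lra.
Import Order.TTheory GRing.Theory Num.Theory.
Import numFieldNormedType.Exports.
Local Open Scope classical_set_scope.
Local Open Scope ring_scope.

Set Implicit Arguments.
Unset Strict Implicit.
Unset Printing Implicit Defensive.

(** * Absolute continuity and one-sided derivatives *)

(** The dynamics hold only almost everywhere, so the argument rests on one principle: an absolutely
    continuous function whose right derivative is nonpositive almost everywhere does not increase.
    It yields the order preservation of two queues with a common inflow and, applied to [w - prim f]
    and its opposite, the recovery of a function from its derivative. One-sided derivatives enter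
    because a reflected queue has kinks where it empties; writing its length as a primitive restores
    the two-sided derivative almost everywhere. The periodic departure rates are built to have mean
    [throughput], so that the stability condition becomes the negative drift of each single queue.
    Uniqueness of the periodic trajectory has no separate argument: any other one must converge to
    it, and periodicity carries the equality back to time 0. *)

Lemma lebesgue_measure_shift (R : realType) (a : R) (A : set R) :
  measurable A ->
  pushforward (@lebesgue_measure R)
    ((fun x => x + a) : R -> measurableTypeR R) A = lebesgue_measure A.
Proof.
have ms : measurable_fun [set: R] (fun x : R => x + a : measurableTypeR R).
  exact: measurable_funD.
move=> mA; apply/esym/lebesgue_measure_unique => //= _ [[u v]] _ <-.
rewrite /pushforward.
have -> : (fun x : R => x + a) @^-1` `]u, v] = `]u - a, v - a]%classic.
  by apply/seteqP; split => x /=; rewrite !in_itv/= ltrBlDr lerBrDr.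
rewrite !lebesgue_measure_itv/= !lte_fin ltrD2r.
by case: ifP => // _; rewrite -!EFinB; congr EFin; ring.
Qed.

#[local] Instance lebesgue_ae_filter (R : realType) :
  Filter (nbhs (almost_everywhere (@lebesgue_measure R))).
Proof. exact: ae_filter_ringOfSetsType. Qed.

Lemma ae_shift (R : realType) (a : R) (P : R -> Prop) :
  {ae (@lebesgue_measure R), forall t, P t} ->
  {ae (@lebesgue_measure R), forall t, P (t + a)}.
Proof.
move=> [A [mA A0 PA]]; exists ((fun x => x + a) @^-1` A); split.
- rewrite -[X in measurable X]setTI.
  have ms : measurable_fun [set: R] (fun x : R => x + a) by exact: measurable_funD.
  exact: ms.
- by rewrite -[RHS]A0; exact: lebesgue_measure_shift.
- by move=> t /= Pt; apply: PA.
Qed.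

Lemma ae_neq (R : realType) (a : R) :
  {ae (@lebesgue_measure R), forall t, t != a}.
Proof.
exists [set a]; split => //; first exact: lebesgue_measure_set1.
by move=> t /= /negP/negbNE/eqP.
Qed.

(** The error is bounded by a multiple of [h] rather than by a limit of quotients, so for fixed [e]
    this is directly a bound on increments. *)
Definition right_derivative (R : realType) (f : R -> R) (t l : R) :=
  forall e, 0 < e -> exists2 d, 0 < d &
    forall h, 0 < h < d -> `|f (t + h) - f t - l * h| <= e * h.

Lemma is_derive_right (R : realType) (f : R -> R) (t l : R) :
  is_derive t 1 f l -> right_derivative f t l.
Proof.
move=> fl e e0; have df : derivable f t 1 by exact: ex_derive.
move/cvg_ex : df => [l' fl'].
have ll' : l' = l by rewrite -(@derive_val _ _ _ _ _ _ _ fl); apply/esym/cvg_lim.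
move/cvgrPdist_le : fl' => /(_ e e0); rewrite ll'.
move=> -[d /= d0 hd]; exists d => // h /andP[h0 hd'].
have h0' : h != 0 by rewrite gt_eqF.
have := hd h; rewrite /ball/= sub0r normrN gtr0_norm// => /(_ hd' h0').
rewrite -[_%:A]/(h * 1) mulr1 -[_ *: _]/(_ * _) (addrC h t) => H.
have -> : f (t + h) - f t - l * h = - (h * (l - h^-1 * (f (t + h) - f t))).
  by field.
by rewrite normrN normrM gtr0_norm// mulrC ler_pM2r.
Qed.

Lemma right_derivativeB (R : realType) (f g : R -> R) (t l m : R) :
  right_derivative f t l -> right_derivative g t m ->
  right_derivative (fun s => f s - g s) t (l - m).
Proof.
move=> fl gm e e0; have e2 : 0 < e / 2 by rewrite divr_gt0.
have [d d0 fd] := fl _ e2; have [d' d'0 gd] := gm _ e2.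
exists (Num.min d d'); first by rewrite lt_min d0.
move=> h /andP[h0]; rewrite lt_min => /andP[hd hd'].
have := fd h; rewrite h0 hd => /(_ isT); have := gd h; rewrite h0 hd' => /(_ isT).
rewrite !ler_norml => /andP[? ?] /andP[? ?]; apply/andP; split; lra.
Qed.

Lemma right_derivativeN (R : realType) (f : R -> R) (t l : R) :
  right_derivative f t l -> right_derivative (fun s => - f s) t (- l).
Proof.
move=> fl e /fl[d d0 fd]; exists d => // h /fd.
by rewrite -normrN; congr (`|_| <= _); ring.
Qed.

Section absolutely_continuous.
Context {R : realType}.
Implicit Types (a b c d : R) (f g w : R -> R).

Lemma absolutely_continuousS a b c d f : a <= c -> d <= b ->
  absolutely_continuous_on a b f -> absolutely_continuous_on c d f.
Proof.
move=> ac db fac e /fac[delta delta0 fd]; exists delta => // m u v uv.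
apply: fd => k; have [cu [-> vd]] := uv k.
by split; [exact: le_trans cu|split => //; exact: le_trans db].
Qed.

Lemma absolutely_continuousB a b f g :
  absolutely_continuous_on a b f -> absolutely_continuous_on a b g ->
  absolutely_continuous_on a b (fun t => f t - g t).
Proof.
move=> fac gac e e0; have e2 : 0 < e / 2 by rewrite divr_gt0.
have [d d0 fd] := fac _ e2; have [d' d'0 gd] := gac _ e2.
exists (Num.min d d'); first by rewrite lt_min d0.
move=> m u v uv dis; rewrite lt_min => /andP[sd sd'].
rewrite (splitr e).
apply: le_lt_trans (ltrD (fd _ _ _ uv dis sd) (gd _ _ _ uv dis sd')).
rewrite -big_split/=; apply: ler_sum => k _.
have -> : f (v k) - g (v k) - (f (u k) - g (u k)) =
  (f (v k) - f (u k)) - (g (v k) - g (u k)) by ring.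
exact: ler_normB.
Qed.

(** A list form with the latest interval at the head, so that an argument moving forward in time
    extends the family by [::]. *)
Lemma absolutely_continuous_seq a b f : absolutely_continuous_on a b f ->
  forall e, 0 < e -> exists2 delta, 0 < delta &
    forall s : seq (R * R), all (fun p => [&& a <= p.1, p.1 <= p.2 & p.2 <= b]) s ->
      pairwise (fun p q => q.2 <= p.1) s ->
      \sum_(p <- s) (p.2 - p.1) < delta ->
      \sum_(p <- s) `|f p.2 - f p.1| < e.
Proof.
move=> fac e /fac[delta delta0 fd]; exists delta => // s sab sdis.
pose u (k : 'I_(size s)) := (nth (a, a) s k).1.
pose v (k : 'I_(size s)) := (nth (a, a) s k).2.
rewrite (big_nth (a, a)) big_mkord => sd.
rewrite (big_nth (a, a)) big_mkord; apply: (fd _ u v) => //.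
  move=> k; have /allP/(_ (nth (a, a) s k)) := sab.
  by rewrite mem_nth// => /(_ isT)/and3P[].
move=> k l kl; have [lt|le] := ltnP k l.
  by right; move/(pairwiseP (a, a)) : sdis => /(_ k l); rewrite !inE; apply.
have {}le : (l < k)%N by rewrite ltn_neqAle le andbT eq_sym.
by left; move/(pairwiseP (a, a)) : sdis => /(_ l k); rewrite !inE; apply.
Qed.

Lemma absolutely_continuous_dist a b f : absolutely_continuous_on a b f ->
  forall e, 0 < e -> exists2 delta, 0 < delta &
    forall s t, a <= s -> s <= t -> t <= b -> t - s < delta -> `|f t - f s| < e.
Proof.
move=> /absolutely_continuous_seq fac e /fac[delta delta0 fd].
exists delta => // s t as_ st tb d.
have := fd [:: (s, t)]; rewrite !big_seq1/=; apply => //.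
by rewrite as_ st tb.
Qed.

(* Creeping along [a, b]: inside an open set of small measure that covers the
   exceptional null set, the increments of [w] are collected in the list [s] and
   are controlled by absolute continuity; elsewhere the right derivative is
   used. *)
Lemma absolutely_continuous_nonincreasing a b w : a <= b ->
  absolutely_continuous_on a b w ->
  {ae (@lebesgue_measure R), forall t, a < t < b ->
    exists2 l, l <= 0 & right_derivative w t l} ->
  w b <= w a.
Proof.
move=> ab wac wae.
suff H e : 0 < e -> w b - w a <= e * (b - a) + e.
  rewrite -subr_le0 leNgt; apply/negP => wba.
  have ba : 0 < b - a + 1 by rewrite ltr_wpDl// subr_ge0.
  have /H : 0 < (w b - w a) / (2 * (b - a + 1)) by rewrite divr_gt0// mulr_gt0.
  have -> x : x * (b - a) + x = x * (b - a + 1) by ring.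
  rewrite invfM mulrA divfK ?gt_eqF// => ?; lra.
move=> e0; have [delta delta0 wd] := absolutely_continuous_seq wac e0.
have : {ae (@lebesgue_measure R), forall t, a <= t < b ->
    exists2 l, l <= 0 & right_derivative w t l}.
  have := ae_neq a; move: wae; apply: filterS2 => t wt ta /andP[at_ tb].
  by apply: wt; rewrite lt_neqAle eq_sym ta at_ tb.
move=> [A [mA A0 EA]].
have [|U [oU AU Ud]] := lebesgue_regularity_outer mA _ delta0.
  by rewrite [ltLHS](_ : _ = 0%E).
have mU : measurable U by exact: open_measurable.
have {}Ud : (lebesgue_measure U < delta%:E)%E.
  rewrite -(setDUK AU) (le_lt_trans (measureU2 _ _ _))//.
    exact: measurableD.
  by rewrite [X in (X + _)%E](_ : _ = 0%E)// add0e.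
(* The budget: intervals collected up to [t] have total length at most the measure of the cover to
   the left of [t], hence less than [delta]. *)
pose m t := fine (lebesgue_measure (U `&` `[a, t])).
have mfin t : lebesgue_measure (U `&` `[a, t]) \is a fin_num.
  rewrite ge0_fin_numE// (le_lt_trans _ (lt_trans Ud (ltry _)))//.
  by rewrite le_measure// ?inE//; exact: measurableI.
have mle s t : s <= t -> m s <= m t.
  move=> st; rewrite fine_le// le_measure// ?inE//; try exact: measurableI.
  by apply: setIS; apply: subset_itvl; rewrite bnd_simp.
have mb : m b < delta.
  rewrite -lte_fin fineK// (le_lt_trans _ Ud)//.
  by rewrite le_measure// ?inE//; exact: measurableI.
have mU_step c h : a <= c -> 0 < h -> `[c, c + h] `<=` U -> m c + h <= m (c + h).
  move=> ac h0 cU; rewrite -lee_fin EFinD !fineK//.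
  have -> : h%:E = lebesgue_measure (`]c, c + h] : set R).
    by rewrite lebesgue_measure_itv/= lte_fin ltrDl h0 -EFinB addrAC subrr add0r.
  rewrite -measureU//; first last.
  - apply/seteqP; split => // x [[_ /=]]; rewrite !in_itv/= => /andP[_ xc] /andP[cx _].
    by move: (lt_le_trans cx xc); rewrite ltxx.
  - exact: measurableI.
  rewrite le_measure// ?inE//; try exact: measurableI.
    by apply: measurableU => //; exact: measurableI.
  move=> x [[Ux]|] /=; rewrite !in_itv/=.
    by move=> /andP[-> xc]; split => //=; rewrite (le_trans xc)// lerDl ltW.
  move=> /andP[cx xch]; split; last by rewrite (le_trans ac (ltW cx)).
  by apply: cU; rewrite /= in_itv/= xch ltW.
(* The arbitrary slack [k] lets [Q] pass to the supremum [c] of the times reached: by continuity the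
   increment from a nearby time to [c] fits into it. *)
pose Q t := forall k, 0 < k -> exists s : seq (R * R),
  [/\ all (fun p => [&& a <= p.1, p.1 <= p.2 & p.2 <= t]) s,
      pairwise (fun p q => q.2 <= p.1) s,
      \sum_(p <- s) (p.2 - p.1) <= m t &
      w t - w a <= e * (t - a) + \sum_(p <- s) `|w p.2 - w p.1| + k].
suff Qb : Q b.
  apply/ler_addgt0Pr => k /Qb[s [sab sdis sm ws]].
  have := wd _ sab sdis (le_lt_trans sm mb) => ?; lra.
have all_le (s : seq (R * R)) t t' : t <= t' ->
    all (fun p => [&& a <= p.1, p.1 <= p.2 & p.2 <= t]) s ->
    all (fun p => [&& a <= p.1, p.1 <= p.2 & p.2 <= t']) s.
  move=> tt'; apply: sub_all => p /and3P[-> -> pt]/=; exact: le_trans tt'.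
pose S := [set t | a <= t <= b /\ Q t].
have Sa : S a.
  split; first by rewrite lexx.
  move=> k k0; exists [::]; split => //; rewrite big_nil ?fine_ge0//.
  by rewrite !subrr mulr0 !add0r ltW.
have hS : has_sup S by split; [exists a|exists b => t [/andP[]]].
pose c := sup S.
have ac : a <= c by exact: (ub_le_sup hS.2).
have cb : c <= b by apply: ge_sup; [exists a|move=> t [/andP[]]].
have Sc : S c.
  split; first by rewrite ac cb.
  move=> k k0; have k2 : 0 < k / 2 by rewrite divr_gt0.
  have [d d0 wcd] := absolutely_continuous_dist wac k2.
  have [t St ct] := sup_adherent d0 hS.
  have tc : t <= c by exact: (ub_le_sup hS.2).
  have [/andP[at_ tb] Qt] := St.
  have [s [sab sdis sm ws]] := Qt _ k2; exists s; split => //.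
  - exact: all_le tc sab.
  - exact: le_trans (mle _ _ tc).
  have := wcd _ _ at_ tc cb; rewrite ltrBlDl -ltrBlDr => /(_ ct).
  rewrite ltr_norml => /andP[_ ?].
  have : e * (t - a) <= e * (c - a) by rewrite ler_pM2l// lerD2r.
  lra.
have [<-|cb'] := eqVneq c b; first by case: Sc.
have {}cb' : c < b by rewrite lt_neqAle cb'.
suff [h h0 [hb Qh]] : exists2 h, 0 < h & c + h <= b /\ Q (c + h).
  have : c + h <= c.
    apply: (ub_le_sup hS.2); split => //; rewrite hb andbT (le_trans ac)// lerDl ltW//.
  by rewrite gerDl leNgt h0.
have [Uc|Uc] := pselect (U c).
  have /nbhs_ballP[r /= r0 rU] : nbhs c U by exact: open_nbhs_nbhs.
  have r2 : 0 < r / 2 by rewrite divr_gt0.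
  exists (Num.min (r / 2) (b - c)); first by rewrite lt_min r2 subr_gt0.
  set h := Num.min _ _.
  have h0 : 0 < h by rewrite lt_min r2 subr_gt0.
  have hb : c + h <= b by rewrite -lerBrDl ge_min lexx orbT.
  have hr : h < r.
    by rewrite (@le_lt_trans _ _ (r / 2))// ?ge_min ?lexx// ltr_pdivrMr// ltr_pMr// ltr1n.
  split => // k k0; have [s [sab sdis sm ws]] := Sc.2 _ k0.
  exists ((c, c + h) :: s); split => /=.
  - by rewrite ac lexx lerDl (ltW h0)/= (all_le _ _ _ _ sab)// lerDl ltW.
  - by rewrite sdis andbT; apply: sub_all sab => p /and3P[].
  - rewrite big_cons/=.
    suff : m c + h <= m (c + h) by lra.
    apply: mU_step => // x /=; rewrite in_itv/= => /andP[cx xch]; apply: rU.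
    rewrite /ball/= ler0_norm ?subr_le0// opprB ltrBlDl (le_lt_trans xch)//.
    by rewrite ltrD2l.
  - rewrite big_cons/=; have := ler_norm (w (c + h) - w c).
    have : e * (c - a) <= e * (c + h - a) by rewrite ler_pM2l// lerD2r lerDl ltW.
    lra.
have [l l0 wcl] : exists2 l, l <= 0 & right_derivative w c l.
  apply: contrapT => nl; apply: Uc; apply/AU/EA => /= /(_ _).
  by rewrite ac cb' => /(_ isT).
have [d d0 wcd] := wcl _ e0.
have d2 : 0 < d / 2 by rewrite divr_gt0.
exists (Num.min (d / 2) (b - c)); first by rewrite lt_min d2 subr_gt0.
set h := Num.min _ _.
have h0 : 0 < h by rewrite lt_min d2 subr_gt0.
have hb : c + h <= b by rewrite -lerBrDl ge_min lexx orbT.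
have hd : h < d.
  by rewrite (@le_lt_trans _ _ (d / 2))// ?ge_min ?lexx// ltr_pdivrMr// ltr_pMr// ltr1n.
split => // k k0; have [s [sab sdis sm ws]] := Sc.2 _ k0.
have hc : c <= c + h by rewrite lerDl ltW.
exists s; split => //.
- exact: all_le hc sab.
- exact: le_trans (mle _ _ hc).
have := wcd h; rewrite h0 hd => /(_ isT); rewrite ler_norml => /andP[_ ?].
have : l * h <= 0 by rewrite mulr_le0_ge0// ltW.
rewrite !mulrDr; lra.
Qed.

Lemma absolutely_continuousN a b f :
  absolutely_continuous_on a b f ->
  absolutely_continuous_on a b (fun t => - f t).
Proof.
move=> fac e /fac[d d0 fd]; exists d => // m u v uv dis sd.
apply: le_lt_trans (fd _ _ _ uv dis sd); apply: ler_sum => k _.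
by rewrite -opprD normrN.
Qed.

Lemma absolutely_continuous_constant a b w : a <= b ->
  absolutely_continuous_on a b w ->
  {ae (@lebesgue_measure R), forall t, a < t < b -> right_derivative w t 0} ->
  w b = w a.
Proof.
move=> ab wac wae; apply/eqP; rewrite eq_le; apply/andP; split.
  apply: absolutely_continuous_nonincreasing => //.
  by move: wae; apply: filterS => t wt /wt ?; exists 0.
rewrite -lerN2.
apply: (@absolutely_continuous_nonincreasing a b (fun t => - w t)) => //.
  exact: absolutely_continuousN.
move: wae; apply: filterS => t wt /wt ?; exists 0 => //.
by rewrite -oppr0; exact: right_derivativeN.
Qed.

End absolutely_continuous.

(** * Indefinite integrals *)

Definition prim (R : realType) (f : R -> R) (t : R) : R :=
  \int[@lebesgue_measure R]_(s in `[0, t]) f s.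

Section primitive.
Context {R : realType}.
Notation mu := (@lebesgue_measure R).
Implicit Types (f g w : R -> R) (a s t u : R).

Lemma integrable_fromB a f g : integrable_from a f -> integrable_from a g ->
  integrable_from a (fun t => f t - g t).
Proof.
move=> fi gi u.
have : mu.-integrable `[a, u] ((EFin \o f) \- (EFin \o g))%E by exact: integrableB.
by apply: eq_integrable => // x _; rewrite /= EFinB.
Qed.

Lemma integrable_fromD a f g : integrable_from a f -> integrable_from a g ->
  integrable_from a (fun t => f t + g t).
Proof.
move=> fi gi u.
have : mu.-integrable `[a, u] ((EFin \o f) \+ (EFin \o g))%E by exact: integrableD.
by apply: eq_integrable => // x _; rewrite /= EFinD.
Qed.

Lemma integrable_fromZ a k f : integrable_from a f ->
  integrable_from a (fun t => f t * k).
Proof.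
move=> fi u.
have : mu.-integrable `[a, u] ((EFin \o f) \* cst k%:E)%E by exact: integrableZr.
by apply: eq_integrable => // x _; rewrite /= EFinM.
Qed.

Lemma integrable_from_sum a (n : nat) (F : 'I_n -> R -> R) :
  (forall i, integrable_from a (F i)) ->
  integrable_from a (fun t => \sum_i F i t).
Proof.
move=> Fi u; have := @integrable_sum _ _ _ mu `[a, u] (measurable_itv _) _
  (index_enum 'I_n) xpredT (fun i => EFin \o F i) (fun i _ => Fi i u).
by apply: eq_integrable => // x _; rewrite /= sumEFin.
Qed.

Lemma integrable_from_norm a f : integrable_from a f ->
  integrable_from a (fun t => `|f t|).
Proof. by move=> fi u; exact: integrable_norm. Qed.

Lemma integrable_fromS a b f : a <= b -> integrable_from a f ->
  integrable_from b f.
Proof.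
move=> ab fi u; apply: integrableS (fi u) => //.
by apply: subset_itvr; rewrite bnd_simp.
Qed.

Lemma integrable_from_itv f s t u : 0 <= s -> t <= u -> integrable_from 0 f ->
  mu.-integrable `]s, t] (EFin \o f).
Proof.
move=> s0 tu fi; apply: integrableS (fi u) => // x.
by rewrite /= !in_itv/= => /andP[sx xt]; rewrite (le_trans s0 (ltW sx)) (le_trans xt).
Qed.

Lemma prim0 f : prim f 0 = 0.
Proof. by rewrite /prim set_itv1 Rintegral_set1. Qed.

Lemma prim_sub f s t : integrable_from 0 f -> 0 <= s -> s <= t ->
  prim f t - prim f s = \int[mu]_(x in `]s, t]) f x.
Proof. by move=> fi s0 st; rewrite /prim Rintegral_itvB ?bnd_simp. Qed.

Lemma le_prim_sub f s t : integrable_from 0 f -> 0 <= s -> s <= t ->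
  `|prim f t - prim f s| <= prim (fun x => `|f x|) t - prim (fun x => `|f x|) s.
Proof.
move=> fi s0 st; rewrite !prim_sub//; last exact: integrable_from_norm.
by rewrite le_normr_Rintegral//; exact: integrable_from_itv fi.
Qed.

Lemma primB f g t : integrable_from 0 f -> integrable_from 0 g ->
  prim (fun x => f x - g x) t = prim f t - prim g t.
Proof. by move=> fi gi; rewrite /prim RintegralB. Qed.

Lemma primD f g t : integrable_from 0 f -> integrable_from 0 g ->
  prim (fun x => f x + g x) t = prim f t + prim g t.
Proof. by move=> fi gi; rewrite /prim RintegralD. Qed.

Lemma primZ k f t : integrable_from 0 f ->
  prim (fun x => f x * k) t = prim f t * k.
Proof. by move=> fi; rewrite /prim RintegralZr. Qed.

Lemma prim_sum (n : nat) (F : 'I_n -> R -> R) t :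
  (forall i, integrable_from 0 (F i)) ->
  prim (fun x => \sum_i F i x) t = \sum_i prim (F i) t.
Proof.
move=> Fi.
have H (r : seq 'I_n) : integrable_from 0 (fun x => \sum_(i <- r) F i x) /\
    prim (fun x => \sum_(i <- r) F i x) t = \sum_(i <- r) prim (F i) t.
  elim: r => [|i r [IHi IH]].
    have -> : (fun x => \sum_(i <- [::]) F i x) = cst 0.
      by apply/funext => x; rewrite big_nil.
    split; last by rewrite big_nil /prim Rintegral_cst// mul0r.
    by move=> u; exact: integrable0.
  have e : (fun x => \sum_(j <- i :: r) F j x) =
    (fun x => F i x + \sum_(j <- r) F j x).
    by apply/funext => x; rewrite big_cons.
  rewrite e; split; first exact: integrable_fromD.
  by rewrite primD// IH big_cons.
exact: (H _).2.
Qed.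

(** Absolute continuity of the integral as a function of the set: a finite union of intervals of
    small total length carries little mass of [|f|]. It serves both [prim f] and the running
    infimum. *)
Lemma absolutely_continuous_le_prim u f w : integrable_from 0 f ->
  (forall s t, 0 <= s -> s <= t -> t <= u ->
    `|w t - w s| <= prim (fun x => `|f x|) t - prim (fun x => `|f x|) s) ->
  absolutely_continuous_on 0 u w.
Proof.
move=> fi wf e e0.
have intf : mu.-integrable setT (EFin \o f \_ `[0, u]).
  by rewrite -restrict_EFin; apply/integrable_restrict => //=; rewrite setTI.
have [d [d0 fd]] := integral_normr_continuous intf e0.
exists d => // m p q pq dis sd.
(* Half-open intervals, since the given ones may share endpoints and the union must be disjoint. *)
pose E (k : 'I_m) : set R := `]p k, q k]%classic.
have mE k : measurable (E k) by exact: measurable_itv.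
have tE : trivIset setT E.
  apply/trivIsetP => k l _ _ kl; apply/seteqP; split => // x [].
  rewrite /E /= !in_itv/= => /andP[px xq] /andP[px' xq'].
  by case: (dis _ _ kl) => h; [have := le_lt_trans (le_trans xq h) px'|
    have := le_lt_trans (le_trans xq' h) px]; rewrite ltxx.
have muE k : mu (E k) = (q k - p k)%:E.
  rewrite /E lebesgue_measure_itv/= lte_fin; case: ltP => // qp.
  have [_ [pk _]] := pq k.
  have -> : q k = p k by apply/eqP; rewrite eq_le pk qp.
  by rewrite subrr.
have mD : measurable (\big[setU/set0]_(k < m) E k) by exact: bigsetU_measurable.
have Eu k x : E k x -> `[0, u]%classic x.
  rewrite /E /= !in_itv/= => /andP[px xq]; have [p0 [_ qu]] := pq k.
  by rewrite (le_trans p0 (ltW px)) (le_trans xq).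
have muD : (mu (\big[setU/set0]_(k < m) E k) < d%:E)%E.
  rewrite measure_bigsetU_ord//.
  rewrite (_ : (\sum_(k < m) _)%R = (\sum_(k < m) (q k - p k))%:E) ?lte_fin//.
  by rewrite -sumEFin; apply: eq_bigr => k _; exact: muE.
apply: le_lt_trans (fd _ mD muD).
have intfn : mu.-integrable (\big[setU/set0]_(k < m) E k)
    (EFin \o (fun x => `|(f \_ `[0, u]) x|)).
  by apply: integrable_norm; exact: integrableS intf.
rewrite /Rintegral ge0_integral_bigsetU//=; first last.
- by case/integrableP : intfn.
- exact: sub_trivIset tE.
- exact: index_enum_uniq.
rewrite -sum_fine; last first.
  move=> k _; apply: integrable_fin_num; first exact: mE.
  apply: integrable_norm; apply: integrableS intf => //; exact: mE.
apply: ler_sum => k _; have [p0 [pk qu]] := pq k.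
rewrite (le_trans (wf _ _ p0 pk qu))// prim_sub//; last exact: integrable_from_norm.
rewrite le_eqVlt; apply/orP; left; apply/eqP; apply: eq_Rintegral => x.
by rewrite inE => /Eu ux; rewrite patchE mem_set.
Qed.

Lemma prim_absolutely_continuous f u : integrable_from 0 f ->
  absolutely_continuous_on 0 u (prim f).
Proof.
move=> fi; apply: (absolutely_continuous_le_prim fi) => s t s0 st _.
exact: le_prim_sub.
Qed.

(** The fundamental theorem is applied to the truncation of [f] to [[0, k]], whose primitive agrees
    with [prim f] near each point of []0, k[]; the countably many null sets are then merged. *)
Lemma prim_derive f : integrable_from 0 f ->
  {ae mu, forall t, 0 < t -> is_derive t 1 (prim f) (f t)}.
Proof.
move=> fi.
have H (k : nat) : {ae mu, forall t, 0 < t < k%:R -> is_derive t 1 (prim f) (f t)}.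
  pose g := f \_ `[0, k%:R].
  have gi : mu.-integrable setT (EFin \o g).
    by rewrite -restrict_EFin; apply/integrable_restrict => //=; rewrite setTI.
  have gi' y : mu.-integrable `[0, y] (EFin \o g) by exact: integrableS gi.
  have := FTC1 gi' (integrable_locally (measurable_itv _) (fi k%:R)).
  apply: filterS => t; rewrite lte_fin => gt /andP[t0 tk].
  have [dg dgt] := gt t0.
  have <- : g t = f t.
    by rewrite /g patchE mem_set//= in_itv/= !ltW.
  rewrite -dgt derive1E.
  apply: (@near_eq_is_derive _ _ _ (prim g)); last exact/derivableP.
  near=> s; apply: eq_Rintegral => x; rewrite inE/= in_itv/= => /andP[x0 xs].
  rewrite /g patchE mem_set//= in_itv/= x0/= (le_trans xs)//.
  by apply/ltW; near: s; exact: (@lt_nbhsl R).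

have := ae_foralln H; apply: filterS => t tk t0.
by apply: (tk (Num.bound t)); rewrite t0/= archi_boundP// ltW.
Unshelve. all: by end_near. Qed.

(** The difference [w - prim f] has right derivative 0 almost everywhere, hence is constant. *)
Lemma absolutely_continuous_ftc f w s t : integrable_from 0 f -> 0 <= s -> s <= t ->
  absolutely_continuous_on s t w ->
  {ae mu, forall x, s < x < t -> right_derivative w x (f x)} ->
  w t - w s = prim f t - prim f s.
Proof.
move=> fi s0 st wac wf.
suff : w t - prim f t = w s - prim f s by lra.
apply: (absolutely_continuous_constant (w := fun x => w x - prim f x) st).
  apply: absolutely_continuousB => //.
  by apply: (absolutely_continuousS s0 (lexx t)); exact: prim_absolutely_continuous.
move: wf (prim_derive fi); apply: filterS2 => x wx fx /andP[sx xt].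
rewrite -(subrr (f x)); apply: right_derivativeB; first by apply: wx; rewrite sx.
by apply: is_derive_right; apply: fx; rewrite (le_lt_trans s0).
Qed.

Lemma absolutely_continuous_shift a s t f :
  absolutely_continuous_on (s + a) (t + a) f ->
  absolutely_continuous_on s t (fun x => f (x + a)).
Proof.
move=> fac e /fac[d d0 fd]; exists d => // m u v uv dis sd.
apply: (fd _ (fun k => u k + a) (fun k => v k + a)).
- by move=> k; rewrite !lerD2r; exact: uv.
- by move=> k l kl; rewrite !lerD2r; exact: dis.
- rewrite (eq_bigr (fun k => v k - u k))// => k _; ring.
Qed.

Lemma right_derivative_shift a t l f : right_derivative f (t + a) l ->
  right_derivative (fun x => f (x + a)) t l.
Proof.
by move=> fl e /fl[d d0 fd]; exists d => // h /fd; rewrite (addrAC t a h).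
Qed.

(** Translation of the integral, read off from derivatives: [prim f (x + a)] has derivative [g x]
    almost everywhere. Thus [g] and the shift of [f] need only agree on the half-line. *)
Lemma prim_shift a f g t : 0 <= a -> 0 <= t ->
  integrable_from 0 f -> integrable_from 0 g ->
  (forall x, 0 <= x -> g x = f (x + a)) ->
  prim f (t + a) - prim f a = prim g t.
Proof.
move=> a0 t0 fi gi gf.
rewrite -[prim g t]subr0 -(prim0 g) -[in prim f a](add0r a).
apply: (absolutely_continuous_ftc (w := fun x => prim f (x + a))) => //.
  apply: absolutely_continuous_shift; apply: (@absolutely_continuousS _ 0 (t + a)) => //.
    by rewrite add0r.
  exact: prim_absolutely_continuous.
have := ae_shift a (prim_derive fi); apply: filterS => x fx /andP[x0 xt].
apply: right_derivative_shift; rewrite gf ?ltW//; apply: is_derive_right.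
by apply: fx; rewrite ltr_wpDr.
Qed.

End primitive.

(** * Merging of two trajectories of a queue *)

(** One queue of a network with its inflow [a] treated as given. The starting time is a parameter so
    that the queue can be restarted once its upstream queues have merged. *)
Definition queue_from (R : realType) (t0 : R) (a c x b : R -> R) : Prop :=
  [/\ forall t, t0 <= t -> 0 <= x t,
      forall u, t0 <= u -> absolutely_continuous_on t0 u x &
      {ae (@lebesgue_measure R), forall t, t0 <= t ->
        [/\ is_derive t 1 x (a t - b t),
            0 < x t -> b t = c t &
            x t = 0 -> 0 <= b t <= c t]}].

Section single_queue.
Context {R : realType}.
Notation mu := (@lebesgue_measure R).
Implicit Types (a b c f g w x : R -> R) (r s t u T : R).

Lemma absolutely_continuous_within s t f :
  absolutely_continuous_on s t f -> {within `[s, t], continuous f}.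
Proof.
move=> fac; apply/subspace_continuousP => p /=; rewrite in_itv/= => /andP[sp pt].
apply/cvgrPdist_lt => e e0; rewrite near_withinE.
have [d d0 fd] := absolutely_continuous_dist fac e0.
exists d => //= q; rewrite /ball/= ltr_distl in_itv/= => /andP[pq qp] /andP[sq qt].
have [le|/ltW le] := leP p q; last by apply: fd => //; lra.
by rewrite distrC; apply: fd => //; lra.
Qed.

(** If [w t] were positive, then after the last time [r] with [w r <= 0] the function would be
    positive, hence nonincreasing, and could not have risen above [w r]. *)
Lemma absolutely_continuous_nonpos s t w : s <= t ->
  absolutely_continuous_on s t w -> w s <= 0 ->
  {ae mu, forall r, s < r < t -> 0 < w r ->
    exists2 l, l <= 0 & right_derivative w r l} ->
  w t <= 0.
Proof.
move=> st wac ws wae; rewrite leNgt; apply/negP => wt.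
pose S := [set r | s <= r <= t /\ w r <= 0].
have Ss : S s by split => //; rewrite lexx.
have hS : has_sup S by split; [exists s|exists t => r [/andP[]]].
pose r := sup S.
have sr : s <= r by exact: (ub_le_sup hS.2).
have rt : r <= t by apply: ge_sup; [exists s|move=> p [/andP[]]].
have wr : w r <= 0.
  apply/ler_addgt0Pr => e e0; rewrite add0r.
  have [d d0 wd] := absolutely_continuous_dist wac e0.
  have [p Sp rp] := sup_adherent d0 hS.
  have pr : p <= r by exact: (ub_le_sup hS.2).
  have [/andP[sp pt] wp] := Sp.
  have : `|w r - w p| < e by apply: wd => //; rewrite -/r in rp; lra.
  by rewrite ltr_norml => /andP[_ ?]; lra.
have : w t <= w r.
  apply: absolutely_continuous_nonincreasing => //.
    exact: absolutely_continuousS wac.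
  move: wae; apply: filterS => p wp /andP[rp pt].
  apply: wp; first by rewrite pt (le_lt_trans sr).
  rewrite ltNge; apply/negP => wp0.
  have : p <= r by apply: (ub_le_sup hS.2); split => //; rewrite (le_trans sr) ltW.
  by rewrite leNgt rp.
by move=> /le_trans/(_ wr); rewrite leNgt wt.
Qed.

Lemma queue_from_le t0 t1 a c x b : t0 <= t1 ->
  queue_from t0 a c x b -> queue_from t1 a c x b.
Proof.
move=> t01 [x0 xac xae]; split.
- by move=> t t1t; apply: x0; exact: le_trans t1t.
- move=> u t1u; apply: (absolutely_continuousS t01 (lexx u)).
  by apply: xac; exact: le_trans t1u.
- by move: xae; apply: filterS => t xt t1t; apply: xt; exact: le_trans t1t.
Qed.

Lemma queue_from_inflow t0 a a' c x b :
  {ae mu, forall t, t0 <= t -> a t = a' t} ->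
  queue_from t0 a c x b -> queue_from t0 a' c x b.
Proof.
move=> aa' [x0 xac xae]; split => //.
by move: aa' xae; apply: filterS2 => t aa' xt tt; rewrite -aa'//; exact: xt.
Qed.

Lemma queue_from_ac t0 s t a c x b : queue_from t0 a c x b -> t0 <= s -> s <= t ->
  absolutely_continuous_on s t x.
Proof.
move=> [_ xac _] t0s st; apply: (absolutely_continuousS t0s (lexx t)).
by apply: xac; exact: le_trans st.
Qed.

(** While [x] exceeds [x'] it is positive, so it departs at the full rate [c], which [b'] cannot
    exceed; with a common inflow, [x - x'] cannot grow there. *)
Lemma queue_from_le_after a c x b x' b' s :
  queue_from s a c x b -> queue_from s a c x' b' -> x s <= x' s ->
  forall t, s <= t -> x t <= x' t.
Proof.
move=> q q' xs t st; rewrite -subr_le0.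
apply: (absolutely_continuous_nonpos (w := fun r => x r - x' r) st).
- apply: absolutely_continuousB; [exact: (queue_from_ac q)|exact: (queue_from_ac q')].
- by rewrite subr_le0.
have [x0 _ xae] := q; have [x'0 _ x'ae] := q'.
move: xae x'ae; apply: filterS2 => r xr x'r /andP[/ltW sr _].
rewrite subr_gt0 => xx'; have [dx bc _] := xr sr; have [dx' bc' bc0'] := x'r sr.
exists (a r - b r - (a r - b' r)); last first.
  by apply: right_derivativeB; exact: is_derive_right.
have -> : b r = c r by apply: bc; rewrite (le_lt_trans _ xx')// x'0.
have b'c : b' r <= c r.
  have := x'0 r sr; rewrite le_eqVlt => /predU1P[/esym/bc0'/andP[]//|/bc' ->//].
lra.
Qed.

Lemma queue_from_eq_after a c x b x' b' s :
  queue_from s a c x b -> queue_from s a c x' b' -> x s = x' s ->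
  (forall t, s <= t -> x t = x' t) /\
  {ae mu, forall t, s <= t -> b t = b' t}.
Proof.
move=> q q' xs; have xx' t : s <= t -> x t = x' t.
  move=> st; apply/eqP; rewrite eq_le (queue_from_le_after q q')/= ?xs//.
  by rewrite (queue_from_le_after q' q)// xs.
split => //; have [_ _ xae] := q; have [_ _ x'ae] := q'.
(* The derivatives are two-sided, while the lengths are known to agree only from [s] on, so the
   point [s] itself is discarded. *)
have := ae_neq s; move: xae x'ae; apply: filterS3 => t xt x't ts st.
have {}ts : s < t by rewrite lt_neqAle eq_sym ts.
have [dx _ _] := xt st; have [dx' _ _] := x't st.
have dx2 : is_derive t 1 x (a t - b' t).
  apply: (@near_eq_is_derive _ _ _ x').
  near=> r; rewrite xx'//; apply/ltW; near: r; exact: (@lt_nbhsr R).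
have := @derive_val _ _ _ _ _ _ _ dx; rewrite (@derive_val _ _ _ _ _ _ _ dx2).
by move=> ?; lra.
Unshelve. all: by end_near. Qed.

Lemma prim_periodic T f t (k : nat) : 0 < T -> 0 <= t -> integrable_from 0 f ->
  (forall t, 0 <= t -> f (t + T) = f t) ->
  prim f (t + k%:R * T) = prim f t + k%:R * prim f T.
Proof.
move=> T0 t0 fi fT; elim: k => [|k IH]; first by rewrite !mul0r !addr0.
rewrite -natr1 !mulrDl !mul1r addrA.
have kt : 0 <= t + k%:R * T by rewrite addr_ge0// mulr_ge0// ltW.
have gf r : 0 <= r -> f r = f (r + T) by move=> /fT ->.
have := prim_shift (ltW T0) kt fi fi gf.
by rewrite IH => ?; lra.
Qed.

(** A queue that never empties is served at rate [c] throughout, so each period lowers its length by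
    the same amount [prim c T - prim a T > 0], which cannot go on forever. *)
Lemma queue_from_drift t0 a c x b T : 0 < T -> 0 <= t0 ->
  integrable_from 0 a -> integrable_from 0 c ->
  (forall t, 0 <= t -> a (t + T) = a t) ->
  (forall t, 0 <= t -> c (t + T) = c t) ->
  prim a T < prim c T -> queue_from t0 a c x b ->
  exists2 t, t0 <= t & x t = 0.
Proof.
move=> T0 t00 ai ci aT cT ac q; apply: contrapT => nz.
have [x0 _ xae] := q.
have xp t : t0 <= t -> 0 < x t.
  move=> tt; rewrite lt_neqAle x0// andbT; apply/eqP => xt; apply: nz.
  by exists t.
have gi := integrable_fromB ai ci.
have gT t : 0 <= t -> a (t + T) - c (t + T) = a t - c t.
  by move=> t_ge0; rewrite aT// cT.
have xE (k : nat) : x (t0 + k%:R * T) = x t0 + k%:R * (prim a T - prim c T).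
  have k0 : t0 <= t0 + k%:R * T by rewrite lerDl mulr_ge0// ltW.
  rewrite -primB//.
  suff : x (t0 + k%:R * T) - x t0 =
      prim (fun t => a t - c t) (t0 + k%:R * T) - prim (fun t => a t - c t) t0.
    by rewrite (prim_periodic k T0 t00 gi gT) => ?; lra.
  apply: absolutely_continuous_ftc => //; first exact: (queue_from_ac q).
  move: xae; apply: filterS => t xt /andP[/ltW tt _].
  by have [dx bc _] := xt tt; rewrite -bc ?xp//; exact: is_derive_right.
have d0 : 0 < prim c T - prim a T by rewrite subr_gt0.
have xd : 0 <= x t0 / (prim c T - prim a T) by rewrite divr_ge0 ?x0// ltW.
have := archi_boundP xd; rewrite ltr_pdivrMr// => h.
have := xp (t0 + (Num.bound (x t0 / (prim c T - prim a T)))%:R * T).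
rewrite xE lerDl mulr_ge0//; last exact: ltW.
move=> /(_ isT); move: h; set k := _%:R; nra.
Qed.

Lemma queue_from_merge t0 a c x b x' b' T : 0 < T -> 0 <= t0 ->
  integrable_from 0 a -> integrable_from 0 c ->
  (forall t, 0 <= t -> a (t + T) = a t) ->
  (forall t, 0 <= t -> c (t + T) = c t) ->
  prim a T < prim c T ->
  queue_from t0 a c x b -> queue_from t0 a c x' b' ->
  exists2 s, t0 <= s & (forall t, s <= t -> x t = x' t) /\
    {ae mu, forall t, s <= t -> b t = b' t}.
Proof.
move=> T0 t00 ai ci aT cT ac q q'.
suff [s t0s xs] : exists2 s, t0 <= s & x s = x' s.
  exists s => //; apply: (queue_from_eq_after _ _ xs).
    exact: queue_from_le q.
  exact: queue_from_le q'.
have [p t0p xp] := queue_from_drift T0 t00 ai ci aT cT ac q.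
have p0 := le_trans t00 t0p.
have [r pr x'r] := queue_from_drift T0 p0 ai ci aT cT ac (queue_from_le t0p q').
have [x0 _ _] := q; have [x'0 _ _] := q'.
have xr := x0 r (le_trans t0p pr); have x'p := x'0 p t0p.
have wac : absolutely_continuous_on p r (fun t => x t - x' t).
  by apply: absolutely_continuousB; [exact: (queue_from_ac q)|exact: (queue_from_ac q')].
(* [x - x'] is at most 0 at [p], where [x] is empty, and at least 0 at [r], where [x'] is. *)
have [] := IVT (v := 0) pr (absolutely_continuous_within wac).
  by rewrite xp x'r ge_min le_max; apply/andP; split; apply/orP; [left|right]; lra.
move=> s; rewrite in_itv/= => /andP[ps _] xs; exists s; first exact: le_trans ps.
by lra.
Qed.

End single_queue.

(** * Reflection at zero *)

Section integrable_shift.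
Context {R : realType}.
Notation mu := (@lebesgue_measure R).
Implicit Types (f : R -> R) (a u v T : R).

Lemma integrable_shift a u v f : mu.-integrable `[u + a, v + a] (EFin \o f) ->
  mu.-integrable `[u, v] (EFin \o (fun t => f (t + a))).
Proof.
pose phi (t : R) : measurableTypeR R := t + a.
have mphi : measurable_fun [set: R] phi by exact: measurable_funD.
have pre : phi @^-1` `[u + a, v + a] = `[u, v]%classic.
  by apply/seteqP; split => t; rewrite /phi /= !in_itv/= !lerD2r.
move=> /integrableP[mf fi]; apply/integrableP; split.
  move=> _ /= Y mY; rewrite -pre.
  have -> : phi @^-1` `[u + a, v + a] `&` (EFin \o (fun t => f (t + a))) @^-1` Y =
      phi @^-1` (`[u + a, v + a] `&` (EFin \o f) @^-1` Y) by [].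
  rewrite -[X in measurable X]setTI; apply: mphi => //.
  exact: mf.
apply: le_lt_trans fi; rewrite -pre.
rewrite (_ : (\int[mu]_(x in phi @^-1` _) _)%E =
    (\int[pushforward mu phi]_(x in `[(u + a)%R, (v + a)%R]) `|(EFin \o f) x|)%E); last first.
  rewrite ge0_integral_pushforward//; exact: measurableT_comp.
rewrite le_eqVlt; apply/orP; left; apply/eqP.
by apply: eq_measure_integral => A mA _; exact: lebesgue_measure_shift.
Qed.

(** Shifting by enough periods moves any interval into the positive half-line. Negative starting
    points matter because of departure histories and travel delays. *)
Lemma integrable_periodic T f : 0 < T -> (forall t, f (t + T) = f t) ->
  integrable_from 0 f -> forall a, integrable_from a f.
Proof.
move=> T0 fT fi a u.
pose k := Num.bound (`|a| / T).
have ka : `|a| < k%:R * T.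
  by rewrite -ltr_pdivrMr// archi_boundP// divr_ge0// ltW.
have fk (j : nat) t : f (t + j%:R * T) = f t.
  elim: j => [|j IH]; first by rewrite mul0r addr0.
  by rewrite -natr1 mulrDl mul1r addrA fT.
have -> : f = fun t => f (t + k%:R * T) by apply/funext => t; rewrite fk.
apply: integrable_shift; apply: integrableS (fi (u + k%:R * T)) => //.
apply: subset_itvr; rewrite bnd_simp.
have := ler_norm (- a); rewrite normrN; lra.
Qed.

End integrable_shift.

Section reflection.
Context {R : realType}.
Notation mu := (@lebesgue_measure R).
Variables (g : R -> R).
Hypothesis gi : integrable_from 0 g.
Implicit Types (r s t u : R).

Definition running_inf t : R := inf [set prim g s | s in `[0, t]].

Definition reflected t : R := prim g t - running_inf t.

Let P := prim (fun s => `|g s|).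

Let prim_dist s t : 0 <= s -> s <= t -> `|prim g t - prim g s| <= P t - P s.
Proof. exact: le_prim_sub. Qed.

Let P_mono s t : 0 <= s -> s <= t -> P s <= P t.
Proof. by move=> s0 st; rewrite -subr_ge0 (le_trans _ (prim_dist s0 st)). Qed.

Lemma running_inf_le s t : 0 <= s -> s <= t -> running_inf t <= prim g s.
Proof.
move=> s0 st; apply: ge_inf; last by exists s => //=; rewrite in_itv/= s0.
exists (- P t) => _ [r /=] + <-; rewrite in_itv/= => /andP[r0 rt].
have := prim_dist (lexx 0) r0; rewrite prim0 subr0 /P prim0 subr0 -/P.
rewrite ler_norml => /andP[+ _]; apply: le_trans; rewrite lerN2.
exact: P_mono.
Qed.

Lemma le_running_inf t z : 0 <= t ->
  (forall s, 0 <= s -> s <= t -> z <= prim g s) -> z <= running_inf t.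
Proof.
move=> t0 zs; apply: lb_le_inf.
  by exists (prim g 0); exists 0 => //=; rewrite in_itv/= lexx.
by move=> _ [s /=] + <-; rewrite in_itv/= => /andP[]; exact: zs.
Qed.

Lemma running_inf_nonincreasing s t : 0 <= s -> s <= t ->
  running_inf t <= running_inf s.
Proof.
move=> s0 st; apply: le_running_inf => // r r0 rs.
by apply: running_inf_le => //; exact: le_trans st.
Qed.

(** Values of [prim g] before [s] are at least [running_inf s], and later ones differ from
    [prim g s] by at most the mass of [|g|] on [[s, t]]. *)
Lemma running_inf_dist s t : 0 <= s -> s <= t ->
  running_inf s - running_inf t <= P t - P s.
Proof.
move=> s0 st.
suff : running_inf s - (P t - P s) <= running_inf t by lra.
apply: le_running_inf; first exact: le_trans st.
move=> r r0 rt; have := P_mono s0 st; have [rs|/ltW sr] := leP r s.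
  by have := running_inf_le r0 rs; lra.
have := prim_dist s0 sr; rewrite ler_norml => /andP[+ _].
have := P_mono r0 rt; have := running_inf_le s0 (lexx s); lra.
Qed.

Lemma reflected_ge0 t : 0 <= t -> 0 <= reflected t.
Proof. by move=> t0; rewrite subr_ge0 running_inf_le. Qed.

Lemma reflected0 : reflected 0 = 0.
Proof.
apply/eqP; rewrite eq_le reflected_ge0// andbT subr_le0.
apply: le_running_inf => // s s0 s0'.
by have -> : s = 0 by apply/eqP; rewrite eq_le s0 s0'.
Qed.

Lemma reflected_absolutely_continuous u : absolutely_continuous_on 0 u reflected.
Proof.
apply: absolutely_continuousB; first exact: prim_absolutely_continuous.
apply: (absolutely_continuous_le_prim gi) => s t s0 st _.
rewrite distrC ger0_norm; first exact: running_inf_dist.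
by rewrite subr_ge0 running_inf_nonincreasing.
Qed.

(* Only the right derivative: at the end of a busy period the left derivative is
   still [l]. *)
Lemma reflected_right_derivative t l : 0 <= t ->
  right_derivative (prim g) t l ->
  right_derivative reflected t (if 0 < reflected t then l else Num.max l 0).
Proof.
move=> t0 gl e e0; have [xt|] := ltP 0 (reflected t).
  have [d d0 gd] := gl e e0.
  have l0 : 0 < `|l| + e by rewrite ltr_wpDl.
  (* Near [t] the net input falls at speed at most [|l| + e], so within this time it cannot reach
     the old infimum, which therefore stays put. *)
  pose d' := Num.min d (reflected t / (`|l| + e)).
  exists d'; first by rewrite lt_min d0 divr_gt0.
  move=> h /andP[h0]; rewrite lt_min => /andP[hd]; rewrite ltr_pdivlMr// => hx.
  have inf_eq : running_inf (t + h) = running_inf t.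
    have th : t <= t + h by rewrite lerDl ltW.
    apply/eqP; rewrite eq_le running_inf_nonincreasing//=.
    apply: le_running_inf; first exact: le_trans th.
    move=> r r0 rth; have [rt|tr] := leP r t; first exact: running_inf_le.
    have := gd (r - t); have -> : t + (r - t) = r by ring.
    rewrite subr_gt0 tr/= => /(_ _)/wrap[]; first lra.
    rewrite ler_norml => /andP[+ _].
    move: hx; rewrite /reflected.
    have : - (`|l| * h) <= l * (r - t).
      have := ler_norm (- l); rewrite normrN => ?.
      have : (r - t) <= h by lra.
      have := normr_ge0 l; nra.
    nra.
  have := gd h; rewrite h0 hd => /(_ isT); rewrite /reflected inf_eq.
  by congr (`|_| <= _); ring.
move=> xt; have {xt} inf_t : running_inf t = prim g t.
  apply/eqP; rewrite eq_le running_inf_le//=.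
  by move: xt; rewrite subr_le0.
have e2 : 0 < e / 2 by rewrite divr_gt0.
have [d d0 gd] := gl _ e2; exists d => // h /andP[h0 hd].
have th : t <= t + h by rewrite lerDl ltW.
have := gd h; rewrite h0 hd => /(_ isT); rewrite ler_norml => /andP[gh gh'].
have inf_ub := running_inf_nonincreasing t0 th.
have inf_ub' := running_inf_le (le_trans t0 th) (lexx (t + h)).
rewrite inf_t in inf_ub.
(* With [inf_ub] and [inf_ub'], this pins the change of the infimum to [Num.min l 0 * h] up to
   [e / 2 * h]; what remains of [l * h] is [Num.max l 0 * h]. *)
have inf_lb : prim g t + (Num.min l 0 - e / 2) * h <= running_inf (t + h).
  apply: le_running_inf; first exact: le_trans th.
  have m0 : Num.min l 0 <= 0 by rewrite ge_min lexx orbT.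
  have ml : Num.min l 0 <= l by rewrite ge_min lexx.
  move=> r r0 rth; have [rt|tr] := leP r t.
    have := running_inf_le r0 rt; rewrite inf_t.
    have : (Num.min l 0 - e / 2) * h <= 0 by rewrite mulr_le0_ge0// ?ltW//; lra.
    lra.
  have := gd (r - t); have -> : t + (r - t) = r by ring.
  rewrite subr_gt0 tr/= => /(_ _)/wrap[]; first lra.
  rewrite ler_norml => /andP[+ _].
  have rh : r - t <= h by lra.
  have tr0 : 0 < r - t by lra.
  nra.
rewrite /reflected inf_t subrr subr0 ler_norml.
have hmax : Num.max l 0 * h = l * h - Num.min l 0 * h.
  by rewrite -mulrBl; congr (_ * _); have := addr_max_min l 0; lra.
rewrite hmax; apply/andP; split; last by lra.
have [l0|l0] := leP l 0; lra.
Qed.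

End reflection.

(** * The queue that starts empty *)

Section queue_existence.
Context {R : realType}.
Notation mu := (@lebesgue_measure R).
Variables (a c : R -> R).
Hypotheses (ai : integrable_from 0 a) (ci : integrable_from 0 c).
Hypotheses (a0 : forall t, 0 <= t -> 0 <= a t) (c0 : forall t, 0 <= t -> 0 <= c t).
Implicit Types (s t u : R).

Let gi : integrable_from 0 (fun t => a t - c t).
Proof. exact: integrable_fromB. Qed.

Definition empty_start_length : R -> R := reflected (fun t => a t - c t).

(* On an empty queue the reflected length has right derivative [max (a - c) 0],
   which forces the departure rate [min a c]. *)
Definition empty_start_departure t : R :=
  if 0 < empty_start_length t then c t else Num.min (a t) (c t).

Local Notation X := empty_start_length.
Local Notation B := empty_start_departure.

Lemma empty_start_departure_itv t : 0 <= t -> 0 <= B t <= c t.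
Proof.
move=> t0; rewrite /B; case: ifP => _; first by rewrite lexx c0.
by rewrite le_min a0// c0// ge_min lexx orbT.
Qed.

Lemma empty_start_departure_integrable : integrable_from 0 B.
Proof.
move=> u; have mX : measurable_fun `[0, u] X.
  apply: (@subspace_continuous_measurable_fun R) => //.
  exact/absolutely_continuous_within/reflected_absolutely_continuous.
have mc : measurable_fun `[0, u] c.
  by apply/measurable_EFinP; case/integrableP : (ci u).
have ma : measurable_fun `[0, u] a.
  by apply/measurable_EFinP; case/integrableP : (ai u).
apply: le_integrable (ci u) => //.
  apply/measurable_EFinP; apply: measurable_fun_if => //.
  - exact: measurable_fun_ltr.
  - by apply: measurable_funS mc => // x [].
  - have mac : measurable_fun `[0, u] (fun t => Num.min (a t) (c t)).
      exact: measurable_minr.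
    by apply: measurable_funS mac => // x [].
move=> t; rewrite /= in_itv/= => /andP[t0 _]; rewrite lee_fin.
have /andP[B0 Bc] := empty_start_departure_itv t0.
by rewrite !ger0_norm// c0.
Qed.

Lemma empty_start_right_derivative :
  {ae mu, forall t, 0 < t -> right_derivative X t (a t - B t)}.
Proof.
have := prim_derive gi; apply: filterS => t + t0 => /(_ t0)/is_derive_right.
move/(reflected_right_derivative gi (ltW t0)); rewrite /B; case: ifP => // _.
by rewrite oppr_min addr_maxr addrC subrr maxC.
Qed.

(** As a primitive, the length has a two-sided derivative almost everywhere, as [queue_from]
    demands; reflection alone gives only the right derivative. *)
Lemma empty_start_lengthE t : 0 <= t -> X t = prim (fun s => a s - B s) t.
Proof.
move=> t0; have := absolutely_continuous_ftc (w := X)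
  (integrable_fromB ai empty_start_departure_integrable) (lexx 0) t0.
rewrite prim0 !subr0 [X 0](reflected0 gi) subr0; apply.
  exact: reflected_absolutely_continuous.
by apply: filterS empty_start_right_derivative => s Xs /andP[/Xs].
Qed.

Lemma empty_start_queue : queue_from 0 a c X B.
Proof.
split; first exact: reflected_ge0.
  by move=> u _; exact: reflected_absolutely_continuous.
have := ae_neq (0 : R).
have := prim_derive (integrable_fromB ai empty_start_departure_integrable).
apply: filterS2 => t dt tn0 t0; have {}tn0 : 0 < t by rewrite lt_neqAle eq_sym tn0.
split; last by move=> _; exact: empty_start_departure_itv.
  have {}dt := dt tn0; apply: (@near_eq_is_derive _ _ _ _ _ _ _ _ _ dt).
  near=> s; rewrite -empty_start_lengthE//; apply/ltW; near: s; exact: (@lt_nbhsr R).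
by rewrite /B => ->.
Unshelve. all: by end_near. Qed.

End queue_existence.

(** * The periodic regime of a single queue *)

Section periodic_queue.
Context {R : realType}.
Notation mu := (@lebesgue_measure R).
Variables (a c : R -> R) (T : R).
Hypotheses (T0 : 0 < T).
Hypotheses (ai : integrable_from 0 a) (ci : integrable_from 0 c).
Hypotheses (a0 : forall t, 0 <= t -> 0 <= a t) (c0 : forall t, 0 <= t -> 0 <= c t).
Hypotheses (aT : forall t, 0 <= t -> a (t + T) = a t).
Hypotheses (cT : forall t, 0 <= t -> c (t + T) = c t).
Hypothesis ac : prim a T < prim c T.
Implicit Types (s t u : R).

Local Notation g := (fun t => a t - c t).
Local Notation X := (empty_start_length a c).
Local Notation B := (empty_start_departure a c).

Let gi : integrable_from 0 g. Proof. exact: integrable_fromB. Qed.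

Let Y_shift t : 0 <= t -> prim g (t + T) = prim g t - (prim c T - prim a T).
Proof.
move=> t0; have gT s : 0 <= s -> g s = g (s + T) by move=> s0; rewrite aT// cT.
by have := prim_shift (ltW T0) t0 gi gi gT; rewrite (primB T)// => ?; lra.
Qed.

(* Since [prim g] drops by a fixed amount over each period, for [T <= t] its
   infimum over [0, t + T] is already attained on [T, t + T]. *)
Lemma empty_start_length_periodic t : T <= t -> X (t + T) = X t.
Proof.
move=> Tt; have t0 : 0 <= t by rewrite (le_trans _ Tt)// ltW.
have tT0 : 0 <= t + T by rewrite addr_ge0// ltW.
rewrite /empty_start_length /reflected Y_shift//.
suff : running_inf g (t + T) = running_inf g t - (prim c T - prim a T) by lra.
apply/eqP; rewrite eq_le; apply/andP; split.
  suff : running_inf g (t + T) + (prim c T - prim a T) <= running_inf g t by lra.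
  apply: le_running_inf => // s s0 st.
  have sT0 : 0 <= s + T by rewrite addr_ge0// ltW.
  have := running_inf_le gi sT0 (lerD st (lexx T)); rewrite Y_shift//; lra.
apply: le_running_inf => // s s0 stT; have [sT|/ltW Ts] := leP s T.
  by have := running_inf_le gi s0 (le_trans sT Tt); have := ac; lra.
have sT0 : 0 <= s - T by rewrite subr_ge0.
have sTt : s - T <= t by rewrite lerBlDr.
have := running_inf_le gi sT0 sTt.
have -> : prim g s = prim g (s - T + T) by rewrite subrK.
by rewrite Y_shift//; lra.
Qed.

Lemma empty_start_departure_periodic t (k : nat) : T <= t ->
  B (t + k%:R * T) = B t.
Proof.
move=> Tt; elim: k => [|k IH]; first by rewrite mul0r addr0.
have Tk : T <= t + k%:R * T by rewrite (le_trans Tt)// lerDl mulr_ge0// ltW.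
have k0 : 0 <= t + k%:R * T by rewrite (le_trans _ Tk)// ltW.
rewrite -IH -natr1 mulrDl mul1r addrA /empty_start_departure.
by rewrite empty_start_length_periodic// aT// cT.
Qed.

Lemma periodic_queue_exists : exists x b,
  [/\ queue_from 0 a c x b /\ (forall t, 0 <= t -> x (t + T) = x t),
      forall t, b (t + T) = b t,
      forall t, 0 <= b t,
      forall r, integrable_from r b &
      prim b T = prim a T].
Proof.
(* The argument of [B] is the representative of [t] modulo [T] in [[T, 2 * T[], since [B] is known
   to be periodic only from [T] on. *)
pose b t := B (t - T * (Num.floor (t / T))%:~R + T).
have bE t : 0 <= t -> b t = B (t + T).
  move=> t0; rewrite /b.
  have := floor_ge0 (t / T); rewrite divr_ge0// ?(ltW T0)// => k0.
  have /andP[fl _] := floor_itv (t / T).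
  have kE : (Num.floor (t / T))%:~R = (`|Num.floor (t / T)|%N)%:R :> R.
    by rewrite natr_absz ger0_norm.
  move: fl; rewrite kE => fl; set k := `|_|%N.
  rewrite (_ : t + T = (t - T * k%:R + T) + k%:R * T); last by ring.
  rewrite empty_start_departure_periodic// lerDr subr_ge0 mulrC.
  by rewrite -ler_pdivlMr.
have bT t : b (t + T) = b t.
  rewrite /b mulrDl divff ?gt_eqF// floorDrz ?intr1// floor1 intrD.
  by congr (B _); ring.
have b0 t : 0 <= b t.
  have /andP[fl _] := floor_itv (t / T).
  suff /(empty_start_departure_itv a0 c0)/andP[] :
      0 <= t - T * (Num.floor (t / T))%:~R + T by [].
  by rewrite addr_ge0// ?(ltW T0)// subr_ge0 mulrC -ler_pdivlMr.
have bi0 : integrable_from 0 b.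
  move=> u; have : mu.-integrable `[0, u] (EFin \o (fun t => B (t + T))).
    apply: integrable_shift; rewrite add0r.
    exact: (integrable_fromS (ltW T0) (empty_start_departure_integrable ai ci a0 c0)).
  by apply: eq_integrable => // t; rewrite inE/= in_itv/= => /andP[t0 _]; rewrite bE.
have [X0 Xac Xae] := empty_start_queue ai ci a0 c0.
exists (fun t => X (t + T)), b; split => //.
- split; last by move=> t t0; rewrite empty_start_length_periodic// lerDr.
  split.
  + by move=> t t0; rewrite X0// addr_ge0// ltW.
  + move=> u u0; apply: absolutely_continuous_shift.
    rewrite add0r; apply: (absolutely_continuousS (ltW T0) (lexx _)).
    by apply: Xac; rewrite addr_ge0// ltW.
  + have := ae_shift T Xae; apply: filterS => t Xt t0.
    have [|dX bc bc0] := Xt; first by rewrite addr_ge0// ltW.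
    rewrite bE// -aT// -cT//; split => //.
    rewrite -[X in is_derive _ _ _ X]mulr1.
    exact: (@is_derive1_comp _ X (fun t => t + T) t _ _ dX (is_derive_shift t 1 T)).
- exact: (integrable_periodic T0 bT bi0).
(* The length is the same at [T] and at [T + T], so [a - B] integrates to 0 over this period; both
   integrals are then shifted back to [[0, T]]. *)
have Bi := empty_start_departure_integrable ai ci a0 c0.
rewrite -(prim_shift (ltW T0) (ltW T0) Bi bi0 bE).
have := prim_shift (ltW T0) (ltW T0) ai ai (fun t h => esym (aT h)).
have := empty_start_length_periodic (lexx T).
have TT : 0 <= T + T by rewrite addr_ge0// ltW.
rewrite !empty_start_lengthE// ?(ltW T0)// !primB//; lra.
Qed.

End periodic_queue.

(** * The acyclic network *)

Lemma ae_forall_ord (R : realType) (n : nat) (P : 'I_n -> R -> Prop) :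
  (forall i, {ae (@lebesgue_measure R), forall t, P i t}) ->
  {ae (@lebesgue_measure R), forall t, forall i, P i t}.
Proof.
move=> Pi.
have : forall k : nat, {ae (@lebesgue_measure R), forall t,
    forall i : 'I_n, nat_of_ord i = k -> P i t}.
  move=> k; have [kn|nk] := ltnP k n.
    apply: filterS (Pi (Ordinal kn)) => t Pt i ik.
    by have -> : i = Ordinal kn by exact: val_inj.
  by apply: aeW => t i ik; move: (ltn_ord i); rewrite ik ltnNge nk.
by move=> /ae_foralln; apply: filterS => t Pt i; exact: Pt.
Qed.

Section network.
Context {R : realType} {n : nat} (N : fluid_network R n) (T : R).
Hypothesis T0 : 0 < T.
Hypothesis arrT : forall (i : 'I_n) (t : R), 0 <= t -> arr N i (t + T) = arr N i t.
Hypothesis srvT : forall (i : 'I_n) (t : R), 0 <= t -> srv N i (t + T) = srv N i t.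
Hypothesis NT : stable N T.
Notation mu := (@lebesgue_measure R).
Implicit Types (x b : 'I_n -> R -> R) (i j : 'I_n) (k : nat).

(* For a nonnegative routing matrix: no path of [k] links ends in queue [i]. *)
Definition no_path_into k i := forall j, (rt N ^+ k) j i = 0.

Lemma rt_exp_ge0 k i j : 0 <= (rt N ^+ k) i j.
Proof.
elim: k i j => [|k IH] i j; first by rewrite expr0 mxE ler0n.
by rewrite exprSr mxE sumr_ge0// => l _; rewrite mulr_ge0// rt_ge0.
Qed.

Lemma no_path_into0 i : ~ no_path_into 0 i.
Proof. by move=> /(_ i)/eqP; rewrite expr0 mxE eqxx oner_eq0. Qed.

(** An entry of [rt N ^+ k.+1] is a sum of nonnegative products, so if it vanishes, each product
    with last factor [rt N j i] does. *)
Lemma no_path_into_pred k i j : no_path_into k.+1 i -> rt N j i != 0 ->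
  no_path_into k j.
Proof.
move=> ki rji l; have /eqP := ki l; rewrite exprSr mxE psumr_eq0.
  by move=> /allP/(_ j); rewrite mem_index_enum mulf_eq0 (negbTE rji) orbF => /(_ isT)/eqP.
by move=> m _; rewrite mulr_ge0// ?rt_exp_ge0// rt_ge0.
Qed.

Definition inflow b i t := arr N i t + \sum_j b j (t - tau N j i) * rt N j i.

Lemma eq_inflow b b' i t :
  (forall j, rt N j i != 0 -> b j (t - tau N j i) = b' j (t - tau N j i)) ->
  inflow b i t = inflow b' i t.
Proof.
move=> bb'; congr (_ + _); apply: eq_bigr => j _.
by have [->|/bb' ->] := eqVneq (rt N j i) 0; rewrite ?mulr0.
Qed.

Lemma tau_le_taumax i j : tau N i j <= taumax N.
Proof.
apply: le_trans (le_bigmax _ (fun i => \big[Num.max/0]_j tau N i j) i).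
exact: (le_bigmax _ (fun j => tau N i j)).
Qed.

Lemma taumax_ge0 : 0 <= taumax N.
Proof. exact: bigmax_ge_id. Qed.

(* The mean total flow through queue [i], i.e. the solution of the traffic
   equations. *)
Definition throughput i : R :=
  (invmx (1%:M - (rt N)^T) *m mean T (arr N)) i 0.

Lemma throughput_eq i :
  throughput i = T^-1 * prim (arr N i) T + \sum_j throughput j * rt N j i.
Proof.
rewrite /throughput; move: (mulKVmx (rt_unit N) (mean T (arr N))).
rewrite mulmxBl mul1mx; move: (invmx _ *m _) => v.
move=> /(congr1 (fun u : 'cV_n => u i 0)).
rewrite mxE [X in _ + X]mxE [X in _ - X]mxE [in RHS]mxE -/(prim _ _) => <-.
rewrite (eq_bigr (fun j => v j 0 * rt N j i)) ?subrK// => j _.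
by rewrite [_^T _ _]mxE mulrC.
Qed.

Lemma throughput_lt i : T * throughput i < prim (srv N i) T.
Proof.
have [e e0 /(_ i)] := NT; rewrite !mxE -/(prim _ _) => h.
have {}h : throughput i < T^-1 * prim (srv N i) T.
  by apply: le_lt_trans h; rewrite /throughput mxE lerDl ltW.
by rewrite mulrC -ltr_pdivlMr// mulrC.
Qed.

Definition periodic_departure (b : R -> R) (l : R) :=
  [/\ forall t, b (t + T) = b t, forall t, 0 <= b t,
      forall r, integrable_from r b & prim b T = T * l].

Lemma integrable_delay (b : R -> R) d : (forall r, integrable_from r b) ->
  integrable_from 0 (fun t => b (t - d)).
Proof. by move=> bi u; apply: integrable_shift; exact: bi. Qed.

(** The integral of a periodic function over a window of one period does not depend on where the
    window lies. *)
Lemma prim_delay (b : R -> R) d l : 0 <= d -> periodic_departure b l ->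
  prim (fun t => b (t - d)) T = prim b T.
Proof.
move=> d0 [bT _ bi _]; have hi := integrable_delay d bi.
have hb t : 0 <= t -> b t = b (t + d - d) by rewrite addrK.
have := prim_shift d0 (ltW T0) hi (bi 0) hb.
have hT t : 0 <= t -> b (t + T - d) = b (t - d) by rewrite addrAC bT.
by have := prim_periodic 1 T0 d0 hi hT; rewrite !mul1r (addrC T d) => ->; lra.
Qed.

(** * The inflow of a queue whose upstream departures are periodic *)

Section inflow_periodic.
Variables (b : 'I_n -> R -> R) (i : 'I_n).
Hypothesis bP : forall j, rt N j i != 0 -> periodic_departure (b j) (throughput j).

Let term_integrable j :
  integrable_from 0 (fun t => b j (t - tau N j i) * rt N j i).
Proof.
have [r0|/bP[_ _ bi _]] := eqVneq (rt N j i) 0.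
  have -> : (fun t => b j (t - tau N j i) * rt N j i) = cst 0.
    by apply/funext => t; rewrite r0 mulr0.
  by move=> u; exact: integrable0.
by apply: integrable_fromZ; exact: integrable_delay.
Qed.

Lemma inflow_integrable : integrable_from 0 (inflow b i).
Proof.
apply: integrable_fromD; first exact: arr_integrable.
exact: integrable_from_sum.
Qed.

Lemma inflow_ge0 t : 0 <= t -> 0 <= inflow b i t.
Proof.
move=> t0; rewrite addr_ge0 ?arr_ge0// sumr_ge0// => j _.
have [->|/bP[_ b0 _ _]] := eqVneq (rt N j i) 0; first by rewrite mulr0.
by rewrite mulr_ge0// rt_ge0.
Qed.

Lemma inflow_periodic t : 0 <= t -> inflow b i (t + T) = inflow b i t.
Proof.
move=> t0; rewrite /inflow arrT//; congr (_ + _); apply: eq_bigr => j _.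
have [->|/bP[bT _ _ _]] := eqVneq (rt N j i) 0; first by rewrite !mulr0.
by rewrite addrAC bT.
Qed.

(** Delays do not affect means, so the mean inflow is the right-hand side of the traffic equations
    satisfied by [throughput]. *)
Lemma prim_inflow : prim (inflow b i) T = T * throughput i.
Proof.
rewrite primD//; [|exact: arr_integrable|exact: integrable_from_sum].
rewrite prim_sum// throughput_eq mulrDr mulVKf ?gt_eqF//; congr (_ + _).
rewrite mulr_sumr; apply: eq_bigr => j _.
have [r0|/bP bj] := eqVneq (rt N j i) 0.
  have -> : (fun t => b j (t - tau N j i) * rt N j i) = cst 0.
    by apply/funext => t; rewrite r0 mulr0.
  by rewrite r0 !mulr0 /prim Rintegral_cst// mul0r.
have [_ _ bi bl] := bj.
rewrite primZ; last exact: integrable_delay.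
by rewrite (prim_delay (ltW (tau_gt0 N j i)) bj) bl mulrA.
Qed.

End inflow_periodic.

Definition periodic_queue x b i :=
  [/\ queue_from 0 (inflow b i) (srv N i) (x i) (b i),
      forall t, 0 <= t -> x i (t + T) = x i t &
      periodic_departure (b i) (throughput i)].

(** Each step keeps the queues already built and adds those one link further; queues not yet reached
    carry arbitrary functions. *)
Lemma periodic_queues_upto k : exists x b, forall i, no_path_into k i ->
  periodic_queue x b i.
Proof.
elim: k => [|k [x [b IH]]].
  by exists (fun _ _ => 0), (fun _ _ => 0) => i /no_path_into0.
have : forall i, exists p : (R -> R) * (R -> R),
    (no_path_into k i -> p = (x i, b i)) /\
    (no_path_into k.+1 i ->
      [/\ queue_from 0 (inflow b i) (srv N i) p.1 p.2,
          forall t, 0 <= t -> p.1 (t + T) = p.1 t &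
          periodic_departure p.2 (throughput i)]).
  move=> i; have [ki|nki] := pselect (no_path_into k i).
    by exists (x i, b i); split => // _; exact: IH.
  have [ki|nki'] := pselect (no_path_into k.+1 i); last first.
    by exists (x i, b i); split.
  have bP j : rt N j i != 0 -> periodic_departure (b j) (throughput j).
    by move=> /(no_path_into_pred ki)/IH[].
  have [] := @periodic_queue_exists R (inflow b i) (srv N i) T T0
    (inflow_integrable bP) (srv_integrable N i) (inflow_ge0 bP)
    (@srv_ge0 _ _ N i) (inflow_periodic bP) (@srvT i).
    by rewrite (prim_inflow bP); exact: throughput_lt.
  move=> xi [bi [[q xT] bT b0 bint bm]].
  exists (xi, bi); split => // _; split => //; split => //.
  by rewrite bm (prim_inflow bP).
move=> /choice[f fP]; exists (fun i => (f i).1), (fun i => (f i).2) => i ki.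
have [q xT bp] := (fP i).2 ki; split => //.
(* The inflow was computed from the old rates; it is unchanged because every queue with a link into
   [i] was already built and has been kept. *)
have -> : inflow (fun i => (f i).2) i = inflow b i; last by [].
apply/funext => t; apply: eq_inflow => j /(no_path_into_pred ki) kj.
by rewrite (fP j).1.
Qed.

Lemma trajectory_queue (y : 'I_n -> R) h x b i : trajectory N y h x b ->
  queue_from 0 (inflow b i) (srv N i) (x i) (b i).
Proof.
move=> [_ _ xb xae]; have [xi0 xac _] := xb i; split => //.
by apply: filterS xae => t xt /xt/(_ i).
Qed.

Lemma periodic_queues_trajectory x b : (forall i, periodic_queue x b i) ->
  periodic_trajectory N T x b.
Proof.
move=> xb; split.
(* The rates [b], being defined on the whole line, act as their own initial history. *)
- exists (fun i => x i 0), b; split.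
    move=> i; have [[xi0 _ _] _ [_ b0 bi _]] := xb i.
    by split; [exact: xi0|exact: bi|move=> s _; exact: b0].
  split => //.
  + exact: aeW.
  + move=> i; have [[xi0 xac _] _ [_ _ bi _]] := xb i; split => //.
  + have : {ae mu, forall t : R, forall i, 0 <= t ->
        [/\ is_derive t 1 (x i) (inflow b i t - b i t),
            0 < x i t -> b i t = srv N i t &
            x i t = 0 -> 0 <= b i t <= srv N i t]}.
      by apply: ae_forall_ord => i; have [[_ _ xae] _ _] := xb i.
    by apply: filterS => t xt t0 i; exact: xt.
- by move=> i; have [_ + _] := xb i.
- by apply: aeW => s _ i; have [_ _ [+ _ _ _]] := xb i.
Qed.

(** * Finite-time convergence and uniqueness *)

Section convergence.
Variables (xs bs : 'I_n -> R -> R).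
Hypothesis xbs : forall i, periodic_queue xs bs i.

Definition merged_from x b i s :=
  (forall t, s <= t -> x i t = xs i t) /\
  {ae mu, forall t, s <= t -> b i t = bs i t}.

Lemma merged_from_le x b i s s' : s <= s' ->
  merged_from x b i s -> merged_from x b i s'.
Proof.
move=> ss' [xm bm]; split; first by move=> t s't; apply: xm; exact: le_trans s't.
by apply: filterS bm => t bt s't; apply: bt; exact: le_trans s't.
Qed.

(** After [s + taumax N] the inflow into a queue of the next level equals the periodic one almost
    everywhere, so the queue may be regarded as fed by [inflow bs i] and the single-queue merging
    result applies. *)
Lemma trajectory_merges (y : 'I_n -> R) h x b k : trajectory N y h x b ->
  exists2 s, 0 <= s & forall i, no_path_into k i -> merged_from x b i s.
Proof.
move=> xb; elim: k => [|k [s s0 IH]]; first by exists 0 => // i /no_path_into0.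
have : forall i, exists u, no_path_into k.+1 i -> merged_from x b i u.
  move=> i; have [ki|nki] := pselect (no_path_into k.+1 i); last by exists 0.
  have u0 : 0 <= s + taumax N by rewrite addr_ge0// taumax_ge0.
  have bP j : rt N j i != 0 -> periodic_departure (bs j) (throughput j).
    by move=> _; have [] := xbs j.
  have bbs : {ae mu, forall t, s + taumax N <= t -> inflow b i t = inflow bs i t}.
    have : {ae mu, forall t : R, forall j, s + taumax N <= t -> rt N j i != 0 ->
        b j (t - tau N j i) = bs j (t - tau N j i)}.
      apply: ae_forall_ord => j.
      have [rji|nr] := pselect (is_true (rt N j i != 0)); last first.
        by apply: aeW => t _ /nr.
      have [_ bm] := IH j (no_path_into_pred ki rji).
      apply: filterS (ae_shift (- tau N j i) bm) => t bt st _; apply: bt.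
      by rewrite lerBrDr (le_trans _ st)// lerD2l tau_le_taumax.
    by apply: filterS => t bt st; apply: eq_inflow => j; exact: bt.
  have q := queue_from_inflow bbs (queue_from_le u0 (trajectory_queue i xb)).
  have [qs _ _] := xbs i; have {}qs := queue_from_le u0 qs.
  have [] := queue_from_merge T0 u0 (inflow_integrable bP) (srv_integrable N i)
    (inflow_periodic bP) (@srvT i) _ q qs.
    by rewrite (prim_inflow bP) throughput_lt.
  by move=> u _ xu; exists u.
(* One merging time for the finitely many queues of the level; the neutral value 0 keeps it
   nonnegative. *)
move=> /choice[u uP]; exists (\big[Num.max/0]_i u i); first exact: bigmax_ge_id.
by move=> i /uP; apply: merged_from_le; exact: le_bigmax.
Qed.

(** The additional [taumax N] places the whole history window of the state after the merging time
    [s]. *)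
Lemma merged_same_state x b s t : (forall i, merged_from x b i s) ->
  s + taumax N <= t -> same_state N t x b xs bs.
Proof.
move=> xm st; split=> [i|].
  by apply: (xm i).1; rewrite (le_trans _ st)// lerDl taumax_ge0.
have : {ae mu, forall r, forall i, s <= r -> b i r = bs i r}.
  by apply: ae_forall_ord => i; exact: (xm i).2.
apply: filterS => r br /andP[tr _] i; apply: br.
by rewrite (le_trans _ tr)// lerBrDr.
Qed.

Lemma ae_periodic_iter b k :
  {ae mu, forall s : R, - taumax N <= s -> forall i, b i (s + T) = b i s} ->
  {ae mu, forall s : R, - taumax N <= s -> forall i, b i (s + k%:R * T) = b i s}.
Proof.
move=> bT; elim: k => [|k IH]; first by apply: aeW => s _ i; rewrite mul0r addr0.
move: IH (ae_shift (k%:R * T) bT); apply: filterS2 => s bs' bT' ms i.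
rewrite -natr1 mulrDl mul1r addrA bT' ?bs'//.
by rewrite (le_trans ms)// lerDl mulr_ge0// ltW.
Qed.

(** The states agree at [t + k * T] once this exceeds [s], and periodicity of both trajectories
    carries the agreement back to [t]. *)
Lemma periodic_trajectory_unique x b s : periodic_trajectory N T x b ->
  (forall t, s <= t -> same_state N t x b xs bs) ->
  forall t, 0 <= t -> same_state N t x b xs bs.
Proof.
move=> [_ xT bT] xbs_s t t0.
have xsT i r : 0 <= r -> xs i (r + T) = xs i r by have [_ + _] := xbs i; apply.
have bsT : {ae mu, forall s : R, - taumax N <= s -> forall i, bs i (s + T) = bs i s}.
  by apply: aeW => r _ i; have [_ _ [+ _ _ _]] := xbs i; apply.
pose k := Num.bound (`|s| / T).
have sk : s <= t + k%:R * T.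
  rewrite (le_trans (ler_norm s))// -[`|s|]add0r lerD// ltW//.
  by rewrite -ltr_pdivrMr// archi_boundP// divr_ge0// ltW.
have iterT (f : R -> R) (m : nat) : (forall r, 0 <= r -> f (r + T) = f r) ->
    f (t + m%:R * T) = f t.
  move=> fT; elim: m => [|m IH]; first by rewrite mul0r addr0.
  by rewrite -natr1 mulrDl mul1r addrA fT// addr_ge0// mulr_ge0// ltW.
have [xx bb] := xbs_s _ sk; split=> [i|].
  by have := xx i; rewrite (iterT (x i)) ?(iterT (xs i))//; [exact: xsT|exact: xT].
move: (ae_shift (k%:R * T) bb) (ae_periodic_iter k bT) (ae_periodic_iter k bsT).
apply: filterS3 => r br bTr bsTr /andP[tr rt] i.
have mr : - taumax N <= r by rewrite (le_trans _ tr)// lerBrDr addNr.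
by rewrite -bTr// -bsTr//; apply: br; rewrite addrAC lerD2r tr lerD2r rt.
Qed.

End convergence.

End network.

Unset Implicit Arguments.

Theorem theorem5 (R : realType) (n : nat) (N : fluid_network R n) (T : R)
    (K : nat)
    (hT : 0 < T)
    (harr : forall (i : 'I_n) (t : R), 0 <= t -> arr N i (t + T) = arr N i t)
    (hsrv : forall (i : 'I_n) (t : R), 0 <= t -> srv N i (t + T) = srv N i t)
    (hstable : stable N T)
    (hK : (1 <= K)%N)
    (hnil : rt N ^+ K = 0) :
  exists xs bs : 'I_n -> R -> R,
    [/\ periodic_trajectory N T xs bs,
        forall xp bp : 'I_n -> R -> R, periodic_trajectory N T xp bp ->
          forall t : R, 0 <= t -> same_state N t xp bp xs bs &
        forall (x0 : 'I_n -> R) (b0 : 'I_n -> R -> R),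
          admissible_initial N x0 b0 ->
          forall x b : 'I_n -> R -> R, trajectory N x0 b0 x b ->
          exists2 tstar : R, 0 <= tstar &
            forall t : R, tstar <= t -> same_state N t x b xs bs].
Proof.
(* At level [K] the induction over paths has reached every queue. *)
have KN i : no_path_into N K i by move=> j; rewrite hnil mxE.
have [xs [bs xbs]] := periodic_queues_upto hT harr hsrv hstable K.
have {}xbs i : periodic_queue N T xs bs i by exact: xbs.
have conv (x0 : 'I_n -> R) b0 x b : trajectory N x0 b0 x b ->
    exists2 s, 0 <= s & forall t, s <= t -> same_state N t x b xs bs.
  move=> /(trajectory_merges hT harr hsrv hstable xbs K)[s s0 xm].
  exists (s + taumax N); first by rewrite addr_ge0// taumax_ge0.
  by move=> t; apply: merged_same_state => i; exact: xm.
exists xs, bs; split.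
- exact: periodic_queues_trajectory.
(* A periodic trajectory is in particular a trajectory, so it eventually coincides with the
   constructed one. *)
- move=> xp bp xbp; have [[x0 [b0 [_ /conv[s _ xps]]]] _ _] := xbp.
  exact: (periodic_trajectory_unique hT xbs xbp xps).
- by move=> x0 b0 _ x b; exact: conv.
Qed.
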